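(* Let $G$ be a finite non-abelian group, and let $g \in K(G,G)$ with $g \neq 1$. Let $|E(\Gamma_G^g)|$ denote the number of edges of $\Gamma_G^g$. Then: (a) If $g^2 = 1$, then $$\frac{|G||Z(G)| + 3|Z(G)|^2 - |G|}{2} \leq |E(\Gamma_G^g)| \leq \frac{3|G|^2 - 8|Z(G)|^2 - |G|(|Z(G)| + 2)}{4}.$$ (b) If $g^2 \neq 1$, then $$\frac{2|G||Z(G)| + 6|Z(G)|^2 - |G|^2 - |G|}{2} \leq |E(\Gamma_G^g)| \leq \frac{2|G|^2 - 8|Z(G)|^2 - |G|(|Z(G)| + 1)}{2}.$$
   Context: For $x,y$ in a group, $[x,y] = x^{-1}y^{-1}xy$, and $K(G,G) = \{[x,y] : x,y \in G\}$. $Z(G)$ is the center of $G$. The $g$-noncommuting graph $\Gamma_G^g$ is the simple undirected graph with vertex set $G$ in which two distinct vertices $x,y$ are adjacent if and only if $[x,y] \neq g$ and $[x,y] \neq g^{-1}$. *)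

(* Defs.v *)
From mathcomp Require Import all_boot all_order all_algebra all_fingroup all_solvable.

Set Implicit Arguments.
Unset Strict Implicit.
Unset Printing Implicit Defensive.

Import GroupScope.

Section NoncommutingGraph.

Variable gT : finGroupType.
Implicit Types (G : {group gT}) (g x y : gT).

(* MathComp's [~ x, y] is x^-1 * x ^ y = x^-1 * y^-1 * x * y. *)
Definition gnc_adj g : rel gT :=
  [rel x y | [&& x != y, [~ x, y] != g & [~ x, y] != g^-1]].

Lemma gnc_adj_irr g : irreflexive (gnc_adj g).
Proof. by move=> x; rewrite /gnc_adj /= eqxx. Qed.

Lemma gnc_adj_sym g : symmetric (gnc_adj g).
Proof.
move=> x y; rewrite /gnc_adj /= eq_sym -[[~ x, y]]invg_comm (inj_eq invg_inj).
by rewrite -eq_invg_sym; congr (_ && _); rewrite andbC.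
Qed.

(* Edges are unordered pairs [set x; y], so each edge is counted once. *)
Definition gnc_edges G g : {set {set gT}} :=
  [set [set x; y] | x in G, y in G & gnc_adj g x y].

End NoncommutingGraph.

(* Main.v *)
Require Import Defs.
From mathcomp Require Import all_boot all_order all_algebra all_fingroup all_solvable.
From mathcomp Require Import lra.

(** Write n = |G| and z = |Z(G)|.  Both pairs of bounds follow from the
    estimates 2nz - z^2 - z <= 2|E| <= n^2 - n.  The upper one
    holds because a loop is never an edge.  The lower one holds because a
    central element commutes with all of G, while adjacency in the
    g-noncommuting graph can only fail for distinct elements whose commutator
    is g or its inverse, hence nontrivial: so every central element is adjacent
    to all the other elements of G.

    The stated bounds are weaker as soon as 4z <= n ([card_center_nonabelian]),
    which is the only place where the non-commutativity of G enters: it gives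
    nz >= 4z^2 and n(n - z) >= 12z^2, and these absorb the multiples of z^2.

    Edges are counted through ordered pairs of adjacent vertices, each edge
    carrying exactly two of them ([card_adjacent_pairs]). *)

Import GRing.Theory Num.Theory.

(** The index of the center cannot be 1, 2 or 3, since G / Z(G) would then be
    cyclic and G abelian. *)
Lemma card_center_nonabelian {gT : finGroupType} (G : {group gT}) :
  ~~ abelian G -> 4 * #|'Z(G)%g| <= #|G|.
Proof.
move=> nabG; rewrite -(Lagrange (center_sub G)) mulnC leq_mul2l; apply/orP; right.
have idxE : #|(G / 'Z(G))%g| = #|G : 'Z(G)|%g by rewrite card_quotient ?gFnorm.
have ncyc : ~~ cyclic (G / 'Z(G))%g.
  by apply: contra nabG; apply: cyclic_factor_abelian.
rewrite leqNgt; apply: contra ncyc; rewrite -idxE.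
case cardQ: #|_| => [|[|[|[|k]]]] // _; last 2 first.
- by apply: prime_cyclic; rewrite cardQ.
- by apply: prime_cyclic; rewrite cardQ.
- by have := cardG_gt0 (G / 'Z(G))%G; rewrite cardQ.
- by rewrite (card1_trivg cardQ) cyclic1.
Qed.

Definition adjacent_pairs {T : finType} (A : {set T}) (e : rel T) : {set T * T} :=
  [set p in setX A A | e p.1 p.2].

Lemma card_adjacent_pairs {T : finType} (A : {set T}) (e : rel T) :
    irreflexive e -> symmetric e ->
  #|adjacent_pairs A e| =
    2 * #|[set [set x; y] | x in A, y in A & e x y]|.
Proof.
move=> e_irr e_sym; pose f (p : T * T) := [set p.1; p.2].
have -> : [set [set x; y] | x in A, y in A & e x y] = f @: adjacent_pairs A e.
  apply/setP=> E; apply/imset2P/imsetP => [[x y Ax + ->]|[[x y]]].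
    rewrite inE => /andP[Ay exy].
    by exists (x, y); rewrite ?inE /= ?Ax ?Ay.
  rewrite !inE /= => /andP[/andP[Ax Ay] exy] ->.
  by exists x y; rewrite ?inE ?Ay.
rewrite -sum1_card (partition_big_imset f) /= mulnC -sum_nat_const.
apply: eq_bigr => _ /imsetP[[x y] + ->].
rewrite !inE /= => /andP[/andP[Ax Ay] exy].
have neq_xy : x != y by apply: contraTneq exy => ->; rewrite e_irr.
(* The fibre over {x, y} consists of the two orientations of the edge. *)
rewrite sum1_card (@eq_card _ _ [set (x, y); (y, x)]) => [|[u v]].
  by rewrite cards2 xpair_eqE negb_and neq_xy.
rewrite unfold_in /= !inE /= !xpair_eqE /f /=; apply/idP/idP.
  case/andP=> /andP[_ euv] /eqP Euv.
  have neq_uv : u != v by apply: contraTneq euv => ->; rewrite e_irr.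
  have := set21 u v; have := set22 u v; rewrite Euv !inE.
  by case/orP=> /eqP vE /orP[] /eqP uE; move: neq_uv; rewrite uE vE !eqxx ?orbT.
case/orP=> /andP[/eqP-> /eqP->]; first by rewrite Ax Ay exy /=.
by rewrite Ax Ay e_sym exy setUC /=.
Qed.

Lemma card_adjacent_pairs_le {T : finType} (A : {set T}) (e : rel T) :
  irreflexive e -> #|adjacent_pairs A e| + #|A| <= #|A| * #|A|.
Proof.
move=> e_irr; pose diag := [set (x, x) | x in A].
have <- : #|diag| = #|A| by rewrite card_imset // => x y [].
rewrite -cardsUI (_ : _ :&: _ = set0) ?cards0 ?addn0.
  rewrite card_imset -?cardsX; last by move=> x y [].
  apply/subset_leq_card/subsetP => p; rewrite inE => /orP[|/imsetP[x Ax ->]].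
    by rewrite inE => /andP[].
  by rewrite inE /= Ax.
apply/setP=> p; rewrite inE [RHS]inE; apply/negP=> /andP[+ /imsetP[x _ pE]].
by rewrite inE pE /= e_irr andbF.
Qed.

(** Inclusion-exclusion on the pairs of A with at least one coordinate in B: apart
    from the diagonal of B they are all adjacent. *)
Lemma card_adjacent_pairs_ge {T : finType} (A B : {set T}) (e : rel T) :
    symmetric e -> B \subset A ->
    {in B & A, forall x y, x != y -> e x y} ->
  2 * (#|A| * #|B|) <= #|adjacent_pairs A e| + #|B| + #|B| * #|B|.
Proof.
move=> e_sym /subsetP sBA e_full; pose diag := [set (x, x) | x in B].
have -> : 2 * (#|A| * #|B|) = #|setX A B| + #|setX B A|.
  by rewrite !cardsX [#|B| * _]mulnC addnn mul2n.
rewrite -cardsUI -(cardsX B B); apply: leq_add; last first.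
  apply/subset_leq_card/subsetP=> p; rewrite !inE.
  by case/andP=> /andP[_ ->] /andP[->].
apply: (@leq_trans #|adjacent_pairs A e :|: diag|); last first.
  by rewrite (leq_trans (leq_card_setU _ _)) ?leq_add2l ?leq_imset_card.
apply/subset_leq_card/subsetP=> -[x y]; rewrite !inE /= => xyAB.
have [eq_xy|neq_xy] := eqVneq x y.
  rewrite -eq_xy in xyAB *; apply/orP; right; apply: imset_f.
  by case/orP: xyAB => /andP[].
case/orP: xyAB => /andP[xX yY]; apply/orP; left.
  by rewrite xX sBA //= e_sym e_full // eq_sym.
by rewrite sBA // yY e_full.
Qed.

(** Commutators with a central element are trivial, so they avoid g and its
    inverse. *)
Lemma gnc_adj_center {gT : finGroupType} (G : {group gT}) (g : gT) :
  g <> 1%g -> {in 'Z(G)%g & G, forall x y, x != y -> gnc_adj g x y}.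
Proof.
move=> /eqP g1 x y /centerP[_ xC] Gy neq_xy; rewrite /gnc_adj /= neq_xy.
have /commgP/eqP -> := xC y Gy.
by rewrite eq_sym g1 eq_sym invg_eq1.
Qed.

Local Open Scope ring_scope.

Theorem corollary4p5 (gT : finGroupType) (G : {group gT}) (g : gT)
    (hG : ~~ abelian G) (hg : g \in commg_set G G) (hg1 : g <> 1%g) :
  let n : rat := #|G|%:R in
  let z : rat := #|'Z(G)%g|%:R in
  let e : rat := #|gnc_edges G g|%:R in
  ((g ^+ 2 = 1)%g ->
     (n * z + 3 * z ^+ 2 - n) / 2 <= e
     /\ e <= (3 * n ^+ 2 - 8 * z ^+ 2 - n * (z + 2)) / 4)
  /\
  ((g ^+ 2 <> 1)%g ->
     (2 * n * z + 6 * z ^+ 2 - n ^+ 2 - n) / 2 <= e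
     /\ e <= (2 * n ^+ 2 - 8 * z ^+ 2 - n * (z + 1)) / 2).
Proof.
move=> n z e.
have edgesE := card_adjacent_pairs G _ (gnc_adj_irr g) (gnc_adj_sym g).
have z_ge0 : 0 <= z by apply: ler0n.
have n_ge4z : 4 * z <= n.
  by have := card_center_nonabelian _ hG; rewrite -(ler_nat rat) natrM.
have e_le : 2 * e + n <= n * n.
  have := card_adjacent_pairs_le G _ (gnc_adj_irr g).
  by rewrite edgesE -(ler_nat rat) natrD !natrM.
have e_ge : 2 * (n * z) <= 2 * e + z + z * z.
  have := card_adjacent_pairs_ge _ _ _ (gnc_adj_sym g) (center_sub G)
    (gnc_adj_center G _ hg1).
  by rewrite edgesE -(ler_nat rat) natrM 2!natrD !natrM.
have zz_ge0 : 0 <= z * z by apply: mulr_ge0.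
have nz_ge : 4 * (z * z) <= n * z by rewrite mulrA ler_wpM2r.
have nn_ge : 12 * (z * z) <= n * n - n * z.
  have : 0 <= (n - 4 * z) * (n + 3 * z) by apply: mulr_ge0; lra.
  lra.
by rewrite !expr2; split=> _; split; lra.
Qed.
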